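(* Let $T$ be a tree, let $S_1 = (G_1, \sigma_1)$ be a signed graph, let $S_2 = (T, \sigma_2)$ be a signed graph with underlying graph $T$, and let $S = S_1 \times S_2$ be their tensor product. If $\chi'(S_1) = \Delta(S_1)$, then $\chi'(S) = \Delta(S)$.
   Context: All graphs are simple, finite and undirected. A signed graph is a pair $S=(G,\sigma)$ where $G$ is a graph and $\sigma\colon E(G)\to\{+1,-1\}$; $G$ is the underlying graph. $V(S)$, $E(S)$ and $\Delta(S)$ (maximum degree) refer to the underlying graph. An incidence is a pair $v\text{:}e$ of a vertex $v$ and an edge $e$ having $v$ as an endpoint; $I(G)$ is the set of all incidences. For a positive integer $k$ let $M_k=\{0,\pm1,\ldots,\pm l\}$ if $k=2l+1$ and $M_k=\{\pm1,\ldots,\pm l\}$ if $k=2l$. A $k$-edge-coloring of $S=(G,\sigma)$ is a function $f\colon I(G)\to M_k$ such that $f(u\text{:}uv)=-\sigma(uv)f(v\text{:}uv)$ for each edge $uv$, and $f(u\text{:}uv_1)\neq f(u\text{:}uv_2)$ for any two distinct edges $uv_1\neq uv_2$ at a common vertex $u$. The chromatic index $\chi'(S)$ is the smallest $k$ for which $S$ has a $k$-edge-coloring; a signed graph with no edges has chromatic index $0$. The tensor product $S_1\times S_2$ of signed graphs $S_1=(G_1,\sigma_1)$, $S_2=(G_2,\sigma_2)$ is the signed graph with vertex set $V(S_1)\times V(S_2)$ in which $(u,u')(v,v')$ is an edge iff $uv\in E(S_1)$ and $u'v'\in E(S_2)$; the sign of this edge is $\sigma_1(uv)\sigma_2(u'v')$.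 *)

(* Defs.v *)
From mathcomp Require Import all_boot all_order all_algebra.
From mathcomp Require Import boolp.

Set Implicit Arguments.
Unset Strict Implicit.
Unset Printing Implicit Defensive.

Import Order.TTheory GRing.Theory Num.Theory.
Local Open Scope ring_scope.

Record graph (V : finType) := Graph {
  edge :> rel V;
  edge_sym : symmetric edge;
  edge_irr : irreflexive edge }.

Definition max_degree (V : finType) (G : graph V) : nat :=
  (\max_(v : V) #|[set w | edge G v w]|)%N.

Definition connected_graph (V : finType) (G : graph V) : Prop :=
  (0 < #|V|)%N /\ forall u v : V, connect G u v.

(* [ucycle] also accepts the two-vertex cycle u, v, u along a single edge,
   hence the lower bound on the length. *)
Definition acyclic_graph (V : finType) (G : graph V) : Prop :=
  forall c : seq V, (2 < size c)%N -> ~ ucycle G c.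

Definition tree (V : finType) (T : graph V) : Prop :=
  connected_graph T /\ acyclic_graph T.

(* The signature is a symmetric function of the two endpoints of an edge; its
   values on pairs of non-adjacent vertices are irrelevant. *)
Record signed_graph (V : finType) := SignedGraph {
  underlying :> graph V;
  sign : V -> V -> int;
  sign_sym : forall u v, edge underlying u v -> sign u v = sign v u;
  sign_pm1 : forall u v, edge underlying u v -> sign u v = 1 \/ sign u v = -1 }.

(* M_k = {0, +-1, ..., +-l} if k = 2l+1, and {+-1, ..., +-l} if k = 2l; in
   particular M_0 is empty. *)
Definition colors (k : nat) : pred int :=
  [pred x : int | (`|x|%N <= k./2)%N && (odd k || (x != 0))].

(* As the graph is simple, the incidence u:uv is the ordered pair (u, v) of
   adjacent vertices, and f u v stands for f(u:uv); the values of f on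
   non-adjacent pairs are irrelevant. *)
Definition edge_coloring (V : finType) (S : signed_graph V) (k : nat)
    (f : V -> V -> int) : Prop :=
  [/\ forall u v, edge S u v -> f u v \in colors k,
      forall u v, edge S u v -> f u v = - sign S u v * f v u
    & forall u v1 v2, edge S u v1 -> edge S u v2 -> v1 != v2 ->
        f u v1 != f u v2].

Definition edge_colorable (V : finType) (S : signed_graph V) (k : nat) : Prop :=
  exists f : V -> V -> int, edge_coloring S k f.

Lemma edge_colorable_ex (V : finType) (S : signed_graph V) :
  exists k, `[< edge_colorable S k >].
Proof.
pose n (u v : V) : nat := (enum_rank [set u; v]).+1.
pose f u v : int :=
  if (enum_rank u < enum_rank v)%N then (n u v)%:Z
  else - sign S u v * (n u v)%:Z.
have nC u v : n u v = n v u by rewrite /n setUC.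
have absf u v : edge S u v -> `|f u v|%N = n u v.
  move=> uv; rewrite /f; case: ifP => // _.
  by case: (sign_pm1 uv) => ->; rewrite ?opprK ?mulN1r ?mul1r ?abszN absz_nat.
exists (#|{: {set V}}|.*2); apply/asboolP; exists f; split.
- move=> u v uv; rewrite inE absf // doubleK ltn_ord /=.
  by rewrite -absz_eq0 absf // orbT.
- move=> u v uv; rewrite /f; case: ltngtP => [||/val_inj/enum_rank_inj E].
  + move=> _; rewrite -(sign_sym uv) nC.
    by case: (sign_pm1 uv) => ->; rewrite ?opprK ?mulN1r ?mul1r ?opprK.
  + by rewrite nC.
  + by rewrite E edge_irr in uv.
- move=> u v w uv uw vw; apply/eqP => /(congr1 absz).
  rewrite !absf // => -[] /val_inj/enum_rank_inj /setP/(_ v).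
  rewrite !inE eqxx orbT (negPf vw) orbF => /esym/eqP E.
  by rewrite E edge_irr in uv.
Qed.

(* S has a 0-edge-coloring exactly when it has no edges, so the minimum over
   all natural numbers gives 0 for edgeless graphs and ranges over positive k
   otherwise. *)
Definition chromatic_index (V : finType) (S : signed_graph V) : nat :=
  ex_minn (edge_colorable_ex S).

Section TensorProduct.
Variables (V1 V2 : finType).

Definition tensor_edge (G1 : graph V1) (G2 : graph V2) : rel (V1 * V2) :=
  fun x y => edge G1 x.1 y.1 && edge G2 x.2 y.2.

Lemma tensor_edge_sym G1 G2 : symmetric (tensor_edge G1 G2).
Proof. by move=> x y; rewrite /tensor_edge edge_sym (edge_sym G2). Qed.

Lemma tensor_edge_irr G1 G2 : irreflexive (tensor_edge G1 G2).
Proof. by move=> x; rewrite /tensor_edge edge_irr. Qed.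

Definition tensor_graph (G1 : graph V1) (G2 : graph V2) : graph (V1 * V2)%type :=
  Graph (tensor_edge_sym G1 G2) (tensor_edge_irr G1 G2).

Variables (S1 : signed_graph V1) (S2 : signed_graph V2).

Definition tensor_sign (x y : V1 * V2) : int :=
  sign S1 x.1 y.1 * sign S2 x.2 y.2.

Lemma tensor_sign_sym x y :
  edge (tensor_graph S1 S2) x y -> tensor_sign x y = tensor_sign y x.
Proof.
by move=> /andP[h1 h2]; rewrite /tensor_sign (sign_sym h1) (sign_sym h2).
Qed.

Lemma tensor_sign_pm1 x y :
  edge (tensor_graph S1 S2) x y -> tensor_sign x y = 1 \/ tensor_sign x y = -1.
Proof.
move=> /andP[h1 h2]; rewrite /tensor_sign.
by case: (sign_pm1 h1) => ->; case: (sign_pm1 h2) => ->;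
  rewrite ?mul1r ?mulN1r ?opprK; [left|right|right|left].
Qed.

Definition tensor_product : signed_graph (V1 * V2)%type :=
  SignedGraph tensor_sign_sym tensor_sign_pm1.

End TensorProduct.

(* Main.v *)
(* Let k = Delta(S_1), f a k-edge-coloring of S_1, d = Delta(T), and g an
   ordinary edge coloring of the tree T with d colors. Every signature on a
   tree has the form s(xy) = e(x) e(y) with e = +-1, so it can be switched
   away. An incidence of S whose projection to S_1 has color a <> 0 gets the
   color e(x) phi(a, j), where j is the g-color of the projected edge of T and
   phi is odd in its first argument. The color a = 0 (k odd) would collapse
   the d edges above one edge uv of S_1; these are instead colored as a signed
   copy of T, with the signature -sigma_1(uv) sigma_2 switched away, using the
   colors of M_d, which the values of phi avoid. *)
Require Import Defs.
From mathcomp Require Import all_boot all_order all_algebra.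
From mathcomp Require Import boolp zify ring.

Set Implicit Arguments.
Unset Strict Implicit.
Unset Printing Implicit Defensive.

Import Order.TTheory GRing.Theory Num.Theory.
Local Open Scope ring_scope.

(** * Forests: leaves, switching, edge coloring *)

Section Forest.
Variables (V : finType) (G : graph V).
Hypothesis acyclicG : acyclic_graph G.

(* v is an end of a longest simple path inside A. *)
Lemma acyclic_leaf (A : {set V}) :
  A != set0 -> exists2 v, v \in A & (#|[set w in A | G v w]| <= 1)%N.
Proof.
case/set0Pn=> a aA.
pose P n := [exists t : n.-tuple V, [&& uniq t, all [in A] t & sorted G t]].
have exP : exists n, P n.
  by exists 1%N; apply/existsP; exists [tuple a]; rewrite /= aA.
have leP n : P n -> (n <= #|V|)%N.
  case/existsP=> t /and3P[ut _ _].
  by rewrite -(size_tuple t) -(card_uniqP ut) max_card.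
case: (ex_maxnP exP leP) => n /existsP[[s /= /eqP sz]] /and3P[us sA ps] maxn.
case: s sz us sA ps => [|x p] /= sz us sA ps.
  suff /maxn : P 1%N by rewrite -sz.
  by apply/existsP; exists [tuple a]; rewrite /= aA.
case/andP: (sA) => xA _; exists x => //.
rewrite -(cards1 (head x p)); apply/subset_leq_card/subsetP => w.
rewrite !inE => /andP[wA xw].
(* A neighbor of [x] off the path would give a longer path in [A]. *)
have wp : w \in p.
  case: (boolP (w \in x :: p)) => [|wNp].
    by rewrite inE => /orP[/eqP wx|//]; rewrite wx edge_irr in xw.
  suff /maxn : P n.+1 by rewrite ltnn.
  have sz' : size [:: w, x & p] == n.+1 by rewrite -sz.
  apply/existsP; exists (Tuple sz') => /=.
  by rewrite wNp us wA sA edge_sym xw ps.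
(* A neighbor beyond the second vertex of the path closes a cycle of length at least three. *)
case/splitPr: wp us ps {sz sA} => [[|y p1] p2] // us ps.
case: (@acyclicG (x :: rcons (y :: p1) w)); first by rewrite /= size_rcons.
have: uniq ((x :: rcons (y :: p1) w) ++ p2) by rewrite cat_cons cat_rcons.
move: ps; rewrite -cat_rcons cat_path cat_uniq.
move=> /andP[psw _] /andP[uw _]; apply/andP; split=> //.
by rewrite /cycle rcons_path psw last_rcons edge_sym.
Qed.

(** Peeling off leaves and isolated vertices empties any vertex set. In reverse, a structure on a
    forest only ever has to be extended across one new edge. *)
Lemma forest_ind (P : {set V} -> Prop) :
    P set0 ->
    (forall (A : {set V}) v, v \notin A -> (#|[set w in A | G v w]| <= 1)%N ->
       P A -> P (v |: A)) ->
  forall A, P A.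
Proof.
move=> P0 PS A; move: {2}#|A| (erefl #|A|) => n.
elim: n A => [|n IH] A cA; first by rewrite (cards0_eq cA).
have A0 : A != set0 by rewrite -card_gt0 cA.
have [v vA leafv] := acyclic_leaf A0.
rewrite -(setD1K vA); apply: PS; first by rewrite setD11.
- apply: leq_trans leafv; apply/subset_leq_card/subsetP => w.
  by rewrite !inE => /andP[/andP[_ ->] ->].
- by apply: IH; rewrite (cardsD1 v) vA in cA; case: cA.
Qed.

Lemma leaf_cases (A : {set V}) v : (#|[set w in A | G v w]| <= 1)%N ->
  (forall w, w \in A -> G v w = false) \/
  (exists w, [/\ w \in A, G v w & forall x, x \in A -> G v x -> x = w]).
Proof.
move=> /card_le1_eqP le1.
case: (set_0Vmem [set w in A | G v w]) => [E|[w]].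
  by left=> w wA; move/setP/(_ w): E; rewrite !inE wA.
rewrite inE => /andP[wA vw]; right; exists w; split=> // x xA vx.
by apply: le1; rewrite inE ?xA ?wA.
Qed.

(** A new vertex [v] meets at most one edge [vw] into [A], and [e v] can be chosen to suit that
    single constraint. *)
Lemma forest_switching (s : V -> V -> int) :
    (forall u v, G u v -> s u v = s v u) ->
    (forall u v, G u v -> s u v = 1 \/ s u v = -1) ->
  exists2 e : V -> int, forall v, e v = 1 \/ e v = -1 &
    forall u v, G u v -> e u * e v = s u v.
Proof.
move=> sC s1.
suff [e e1 eP] : exists2 e : V -> int, forall v, e v = 1 \/ e v = -1 &
    forall u v, u \in setT -> v \in setT -> G u v -> e u * e v = s u v.
  by exists e => // u v; apply: eP; rewrite inE.
elim/forest_ind: [set: V] => [|A v vA leafv [e e1 eP]].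
  by exists (fun=> 1) => [v|u v]; [left|rewrite inE].
have neq x : x \in A -> (x == v) = false.
  by move=> xA; apply/negbTE; apply: contraNneq vA => <-.
have [isol|[w [wA vw uniqw]]] := leaf_cases leafv.
  exists e => // x y; rewrite !inE => /predU1P[->|xA] /predU1P[->|yA].
  - by rewrite edge_irr.
  - by rewrite isol.
  - by rewrite edge_sym isol.
  - exact: eP.
exists (fun x => if x == v then s v w * e w else e x).
  move=> x; case: ifP => // _.
  by case: (s1 _ _ vw) => ->; case: (e1 w) => ->; rewrite ?mulrN1 ?opprK; auto.
have ew : e w * e w = 1 by case: (e1 w) => ->.
move=> x y; rewrite !inE => /predU1P[->|xA] /predU1P[->|yA].
- by rewrite edge_irr.
- by move=> /(uniqw _ yA) ->; rewrite eqxx (neq w wA) -mulrA ew mulr1.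
- rewrite edge_sym => /(uniqw _ xA) ->.
  by rewrite eqxx (neq w wA) mulrCA ew mulr1 sC.
- by rewrite !neq //; apply: eP.
Qed.

(** Greedy coloring: the edge joining a new leaf [v] to [w] only has to avoid the colors already
    present at [w]. *)
Lemma forest_edge_coloring : exists g : V -> V -> nat,
  [/\ forall u v, G u v -> (g u v < max_degree G)%N,
      forall u v, G u v -> g u v = g v u &
      forall u v w, G u v -> G u w -> g u v = g u w -> v = w].
Proof.
suff [g [g1 g2 g3]] : exists g : V -> V -> nat,
  [/\ forall u v, u \in setT -> v \in setT -> G u v -> (g u v < max_degree G)%N,
      forall u v, u \in setT -> v \in setT -> G u v -> g u v = g v u &
      forall u v w, u \in setT -> v \in setT -> w \in setT ->
        G u v -> G u w -> g u v = g u w -> v = w].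
  by exists g; split=> *; [apply: g1|apply: g2|apply: g3]; rewrite ?inE; eauto.
elim/forest_ind: [set: V] => [|A v vA leafv [g [g1 g2 g3]]].
  by exists (fun _ _ => 0%N); split=> u v; rewrite inE.
have neq x : x \in A -> (x == v) = false.
  by move=> xA; apply/negbTE; apply: contraNneq vA => <-.
have [isol|[w [wA vw uniqw]]] := leaf_cases leafv.
  have isol' x : x \in A -> G x v = false by rewrite edge_sym; apply: isol.
  exists g; split=> [x y|x y|x y z]; rewrite !inE.
  - by move=> /predU1P[->|?] /predU1P[->|?]; rewrite ?edge_irr ?isol ?isol' //; auto.
  - by move=> /predU1P[->|?] /predU1P[->|?]; rewrite ?edge_irr ?isol ?isol' //; auto.
  - move=> /predU1P[->|?] /predU1P[->|?] /predU1P[->|?];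
      rewrite ?edge_irr ?isol ?isol' //; eauto.
have [c ltc freec] : exists2 c, (c < max_degree G)%N &
    forall x, x \in A -> G w x -> g w x != c.
  pose s := [seq g w x | x <- enum [set x in A | G w x]].
  have [/allP sub|/allPn[c]] := boolP (all [in s] (iota 0 (max_degree G))).
    (* If every color occurred at [w], then [w] would have at least [max_degree G] neighbors in [A],
       and [v] is one more outside [A]. *)
    have := uniq_leq_size (iota_uniq _ _) sub.
    rewrite size_iota size_map -cardE leqNgt => /negP[].
    apply: (@leq_trans #|[set x | G w x]|); last exact: leq_bigmax.
    apply/proper_card/properP; split.
      by apply/subsetP => x; rewrite !inE => /andP[].
    by exists v; rewrite !inE ?(negbTE vA) // edge_sym.
  rewrite mem_iota => /= ltc cs; exists c => // x xA wx.
  by apply: contraNneq cs => <-; apply: map_f; rewrite mem_enum inE xA.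
exists (fun x y => if (x == v) || (y == v) then c else g x y).
split=> [x y|x y|x y z]; rewrite !inE.
- move=> /predU1P[->|xA] /predU1P[->|yA]; rewrite ?eqxx ?orbT //.
  by rewrite !neq //=; auto.
- move=> /predU1P[->|xA] /predU1P[->|yA]; rewrite ?eqxx ?orbT //.
  by rewrite !neq //=; auto.
- move=> /predU1P[->|xA] /predU1P[->|yA] /predU1P[->|zA];
    rewrite ?edge_irr ?eqxx ?orbT //= ?(neq x) ?(neq y) ?(neq z) //=.
  + by move=> /(uniqw _ yA) -> /(uniqw _ zA) ->.
  + rewrite edge_sym => /(uniqw _ xA) -> wz /esym/eqP.
    by rewrite (negbTE (freec _ zA wz)).
  + move=> wy; rewrite edge_sym => /(uniqw _ xA) E /eqP; move: wy; rewrite E.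
    by move=> wy; rewrite (negbTE (freec _ yA wy)).
  + exact: g3.
Qed.

End Forest.

(** * Color sets M_k and the lower bound by the degree *)

(* 0 is a color only for odd k, and then k-1 is the index of no other color. *)
Definition color_index (k : nat) (x : int) : nat :=
  if x == 0 then k.-1 else if 0 <= x then (`|x|.-1.*2)%N else (`|x|.-1.*2.+1)%N.

Lemma color_index_lt k x : x \in colors k -> (color_index k x < k)%N.
Proof. rewrite inE /color_index; case: eqP; case: (leP 0 x); lia. Qed.

Lemma color_index_inj k : {in colors k &, injective (color_index k)}.
Proof.
move=> x y; rewrite !inE /color_index.
by case: eqP; case: eqP; case: (leP 0 x); case: (leP 0 y); lia.
Qed.

(** Incidences at one vertex have distinct colors, and [color_index] embeds M_k into k indices. *)
Lemma degree_le_colors (V : finType) (S : signed_graph V) k :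
  edge_colorable S k -> (max_degree S <= k)%N.
Proof.
case=> f [f1 _ f3]; apply/bigmax_leqP => v _.
pose s := [seq color_index k (f v w) | w <- enum [set w | edge S v w]].
have sP w : w \in enum [set w | edge S v w] -> edge S v w.
  by rewrite mem_enum inE.
have us : uniq s.
  rewrite map_inj_in_uniq ?enum_uniq // => x y /sP vx /sP vy.
  move=> /color_index_inj-/(_ (f1 _ _ vx) (f1 _ _ vy)) E.
  by apply/eqP/negPn/negP => /(f3 _ _ _ vx vy)/eqP.
have sub : {subset s <= iota 0 k}.
  move=> _ /mapP[x /sP vx ->]; rewrite mem_iota /=.
  by apply: color_index_lt; apply: f1.
by have := uniq_leq_size us sub; rewrite size_iota size_map -cardE.
Qed.

(** Inverse of [color_index]: the order is 1, -1, 2, -2, and so on, with 0 last when [k] is odd. *)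
Definition color_of_index (k j : nat) : int :=
  if odd k && (j == k.-1) then 0
  else if odd j then - (j./2.+1)%:Z else (j./2.+1)%:Z.

Lemma color_of_index_in k j : (j < k)%N -> color_of_index k j \in colors k.
Proof. by rewrite inE /color_of_index; case: ifP; case: (boolP (odd j)); lia. Qed.

Lemma color_of_index_inj k i j :
  color_of_index k i = color_of_index k j -> i = j.
Proof. by rewrite /color_of_index; do ?case: ifP; lia. Qed.

(** * Colors and degrees in the product *)

(* The shift by k2./2 for odd k1 reserves the colors of M_k2 for the edges
   above the edges of color 0. *)
Definition pair_color (k1 k2 : nat) (a : int) (j : nat) : int :=
  sgz a * ((if odd k1 then k2./2 else 0) + `|a|.-1 * k2 + j.+1)%N%:Z.

Lemma max_degree_tensor (V1 V2 : finType) (G1 : graph V1) (G2 : graph V2) :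
  (max_degree G1 * max_degree G2 <= max_degree (tensor_graph G1 G2))%N.
Proof.
(* A vertex of maximum degree exists only if the vertex set is nonempty; otherwise the left side is
   0. *)
case: (posnP #|V1|) => [V10|V1_gt0].
  rewrite /max_degree big_pred0 // => x.
  by have := fintype0 x V10.
case: (posnP #|V2|) => [V20|V2_gt0].
  rewrite {2}/max_degree big_pred0 ?muln0 // => x.
  by have := fintype0 x V20.
have [u Eu] := bigop.eq_bigmax (fun v => #|[set w | G1 v w]|) V1_gt0.
have [v Ev] := bigop.eq_bigmax (fun v => #|[set w | G2 v w]|) V2_gt0.
rewrite /max_degree Eu Ev -cardsX.
apply: leq_trans (bigop.leq_bigmax (u, v)).
by apply/subset_leq_card/subsetP => -[x y]; rewrite !inE.
Qed.

Lemma mul_pm1_sgz_absz (e a : int) :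
  e = 1 \/ e = -1 -> (sgz (e * a) = e * sgz a) * (`|(e * a)%R|%N = `|a|%N).
Proof. by case=> ->; rewrite ?mul1r ?mulN1r ?sgzN ?abszN. Qed.

Lemma pair_colorN k1 k2 e a j : e = 1 \/ e = -1 ->
  pair_color k1 k2 (e * a) j = e * pair_color k1 k2 a j.
Proof. by move=> e1; rewrite /pair_color !(mul_pm1_sgz_absz _ e1) mulrA. Qed.

Lemma pair_color_abs k1 k2 a j : a != 0 ->
  `|pair_color k1 k2 a j|%N =
    ((if odd k1 then k2./2 else 0) + `|a|.-1 * k2 + j.+1)%N.
Proof. by move=> a0; rewrite /pair_color abszM -sgrz absz_sg a0 mul1n. Qed.

(** The absolute values for a given |a| form a block of [k2] consecutive integers. The [k1./2]
    blocks, after the shift when [k1] is odd, end exactly at [(k1 * k2)./2]. *)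
Lemma pair_color_in k1 k2 a j : a \in colors k1 -> a != 0 -> (j < k2)%N ->
  pair_color k1 k2 a j \in colors (k1 * k2).
Proof.
rewrite inE => /andP[le_a _] a0 ltj; rewrite inE -absz_eq0 pair_color_abs //.
apply/andP; split; last by rewrite addnS orbT.
have : (`|a|.-1.+1 * k2 <= k1./2 * k2)%N by rewrite leq_mul2r; lia.
rewrite mulSn; case: ifP => o1.
  have -> : ((k1 * k2)./2 = k2./2 + k1./2 * k2)%N.
    rewrite -{1}(odd_double_half k1) o1 mulnDl mul1n -doubleMl halfD.
    by rewrite doubleK odd_double andbF.
  by lia.
have -> : ((k1 * k2)./2 = k1./2 * k2)%N.
  by rewrite -{1}(odd_double_half k1) o1 -doubleMl doubleK.
by lia.
Qed.

(** The sign gives back the sign of [a]; once the shift is removed, division by [k2] gives back |a|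
    - 1 and the index. *)
Lemma pair_color_inj k1 k2 (a b : int) i j : a != 0 -> b != 0 ->
  (i < k2)%N -> (j < k2)%N ->
  pair_color k1 k2 a i = pair_color k1 k2 b j -> a = b /\ i = j.
Proof.
move=> a0 b0 lti ltj E.
have Es : sgz a = sgz b.
  move/(congr1 (@sgz int)): E; rewrite /pair_color !addnS !sgzM !sgz_id.
  by rewrite ![sgz (Posz _)]gtr0_sgz ?mulr1.
move/(congr1 absz): E; rewrite !pair_color_abs // => E.
have E' : (`|a|.-1 * k2 + i = `|b|.-1 * k2 + j)%N by lia.
have Eij : i = j.
  by move/(congr1 (modn^~ k2)): E'; rewrite !modnMDl !modn_small.
split=> //; move: E'; rewrite Eij => /addIn/eqP.
rewrite eqn_mul2r => /orP[|/eqP Eab]; first by lia.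
have {}Eab : `|a|%N = `|b|%N by lia.
by rewrite (intEsg a) (intEsg b) Es Eab.
Qed.

(** * The coloring of the tensor product *)

Lemma tensor_edge_colorable (V1 V2 : finType) (S1 : signed_graph V1)
    (S2 : signed_graph V2) k :
  acyclic_graph S2 -> edge_colorable S1 k ->
  edge_colorable (tensor_product S1 S2) (k * max_degree S2).
Proof.
set k2 := max_degree S2 => acS2 [f [f1 f2 f3]].
have [g [g1 g2 g3]] := forest_edge_coloring acS2.
have switch s : s = 1 \/ s = -1 -> exists2 e : V2 -> int,
    forall v, e v = 1 \/ e v = -1 &
    forall u v, S2 u v -> e u * e v = s * sign S2 u v.
  move=> s1; apply: forest_switching => // u v; first by move=> /sign_sym ->.
  by move=> /sign_pm1[] ->; case: s1 => ->; rewrite ?mulr1 ?mulrN1 ?opprK; auto.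
(* Above a nonzero color, [f] itself supplies the factor -sigma_1, so [ep] suffices. Above color 0
   the switching must supply it, hence a choice between [ep] and [em]. *)
have [ep ep1 epP] := switch 1 (or_introl erefl).
have [em em1 emP] := switch (-1) (or_intror erefl).
pose eps (s : int) := if s == 1 then ep else em.
have eps1 s v : eps s v = 1 \/ eps s v = -1 by rewrite /eps; case: ifP.
have epsP s u v : s = 1 \/ s = -1 -> S2 u v ->
    eps s u = s * sign S2 u v * eps s v.
  move=> s1 uv; have -> : s * sign S2 u v = eps s u * eps s v.
    by rewrite /eps; case: s1 => -> /=; rewrite ?epP ?emP.
  by rewrite -mulrA; case: (eps1 s v) => ->; rewrite ?mulrNN !mulr1.
have abs_eps s v x : `|(eps s v * x)%R|%N = `|x|%N.
  by rewrite (mul_pm1_sgz_absz _ (eps1 s v)).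
have eps_inj s v : injective ( *%R (eps s v)).
  by apply: mulfI; case: (eps1 s v) => ->.
have colorsM m s v x : x \in colors m -> eps s v * x \in colors m.
  by rewrite !inE -!absz_eq0 abs_eps.
exists (fun x y => if f x.1 y.1 == 0
  then eps (- sign S1 x.1 y.1) x.2 * color_of_index k2 (g x.2 y.2)
  else eps 1 x.2 * pair_color k k2 (f x.1 y.1) (g x.2 y.2)).
split.
- move=> [u u'] [v v'] /andP[/= uv uv'].
  have := f1 _ _ uv; case: eqVneq => [->|fuv] fin; apply: colorsM; last first.
    by apply: pair_color_in => //; apply: g1.
  (* Color 0 forces [k] odd; then [k * k2] has the parity of [k2], so its color set contains
     M_k2. *)
  have odd_k : odd k by move: fin; rewrite inE /= orbF.
  have /andP[le_c zero_c] := color_of_index_in (g1 _ _ uv').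
  rewrite inE oddM odd_k zero_c andbT.
  exact: leq_trans le_c (half_leq (leq_pmull _ (odd_gt0 odd_k))).
- move=> [u u'] [v v'] /andP[/= uv uv']; rewrite /tensor_sign /=.
  have s1 : - sign S1 u v = 1 \/ - sign S1 u v = -1.
    by case: (sign_pm1 uv) => ->; rewrite ?opprK; auto.
  have fvu : (f u v == 0) = (f v u == 0).
    by rewrite (f2 u v uv) mulf_eq0; case: s1 => ->.
  rewrite fvu -(sign_sym uv) (g2 v' u'); last by rewrite edge_sym.
  case: ifP => _; first by rewrite (epsP _ _ _ s1 uv') -mulNr; ring.
  rewrite (f2 u v uv) (pair_colorN _ _ _ _ s1).
  by rewrite (epsP _ _ _ (or_introl erefl) uv'); ring.
- move=> [u u'] [v v'] [w w'] /andP[/= uv uv'] /andP[/= uw uw'] neq.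
  apply: contraNneq neq.
  (* Absolute values are compared because the two incidences may carry different switching signs.
     Those in M_k2 are at most [k2./2], which the shift exceeds. *)
  have disjoint a i j : a \in colors k -> 0 \in colors k -> a != 0 ->
      (i < k2)%N -> (j < k2)%N ->
      `|color_of_index k2 i|%N <> `|pair_color k k2 a j|%N.
    move=> _; rewrite inE /= orbF => odd_k a0 lti ltj; rewrite pair_color_abs //.
    have /andP[le_c _] := color_of_index_in lti.
    move=> E; move: le_c.
    by rewrite E odd_k -addnA leqNgt addnS addnS ltnS leq_addr.
  have fuv := f1 _ _ uv; have fuw := f1 _ _ uw.
  case: (eqVneq (f u v) 0) (eqVneq (f u w) 0) => [v0|v0] [w0|w0].
  (* Only one edge at [u] has color 0 there, so both incidences use the same switching. *)
  + have vw : v = w.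
      by apply/eqP/negPn/negP=> /(f3 _ _ _ uv uw); rewrite v0 w0 eqxx.
    by rewrite vw => /eps_inj/color_of_index_inj/(g3 _ _ _ uv' uw') ->.
  + move=> /(congr1 absz); rewrite !abs_eps => /disjoint[] //;
      by [rewrite -v0 | apply: g1].
  + move=> /(congr1 absz); rewrite !abs_eps => /esym/disjoint[] //;
      by [rewrite -w0 | apply: g1].
  + move=> /eps_inj/(pair_color_inj v0 w0 (g1 _ _ uv') (g1 _ _ uw'))[E].
    move=> /(g3 _ _ _ uv' uw') ->; apply/eqP; congr pair.
    by apply/eqP/negPn/negP=> /(f3 _ _ _ uv uw); rewrite E eqxx.
Qed.

Theorem theorem20 (V1 V2 : finType) (S1 : signed_graph V1)
    (S2 : signed_graph V2) :
  tree (underlying S2) ->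
  chromatic_index S1 = max_degree (underlying S1) ->
  chromatic_index (tensor_product S1 S2)
    = max_degree (underlying (tensor_product S1 S2)).
Proof.
move=> [_ acS2]; rewrite /chromatic_index.
case: ex_minnP => k1 /asboolP col1 _ Ek1.
case: ex_minnP => k /asboolP col min_k; apply/eqP.
(* What remains is the upper bound, through Delta(S_1) Delta(T) as an intermediate value. *)
rewrite eqn_leq (degree_le_colors col) andbT.
apply: leq_trans (max_degree_tensor S1 S2).
by rewrite -Ek1; apply/min_k/asboolP/tensor_edge_colorable.
Qed.
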